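(* Let $q\equiv 1\pmod 4$ be a prime power and $q=4f+1$. Let $\mathbb{F}_q$ be a finite field of order $q$, let $G=(\mathbb{F}_q,+)$, and let $C_0,C_1,C_2,C_3$ be the cyclotomic classes of order $4$ of $\mathbb{F}_q$. (1) When $P=G-0_G$ and $N=0_G$, $D=P-N$ is a $(q,q,q-4)$-signed difference set. (2) When $P=G-C_l-0_G$ and $N=C_l+0_G$ with $l\in\{0,1,2,3\}$, $D=P-N$ is a $\left(q,q,\frac{q-9}{4}\right)$-signed difference set if and only if $q=4t^2+9$ for some odd integer $t$. (3) When $P=C_i+C_j$ and $N=C_k+C_l+0_G$ with $\{i,j,k,l\}=\{0,1,2,3\}$, $D=P-N$ is not a signed difference set. (4) When $P=C_l$ and $N=G-C_l$ with $l\in\{0,1,2,3\}$, $D=P-N$ is a $\left(q,q,\frac{q-1}{4}\right)$-signed difference set if and only if $q=4t^2+1$ for some odd integer $t$.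
   Context: Fix a primitive element $w$ of $\mathbb{F}_q$. The cyclotomic classes of order $4$ are $C_0=\{w^{4j}:0\le j\le f-1\}$ and $C_i=w^iC_0$ for $0\le i\le 3$. For $G=(\mathbb{F}_q,+)$ with identity $0_G$, a subset $S\subseteq G$ is identified with $\sum_{s\in S}s$ in the group ring $\mathbb{Z}[G]$; thus sums and differences such as $C_i+C_j+0_G$ and $G-C_l-0_G$ are group ring elements, here representing the disjoint union $C_i\cup C_j\cup\{0\}$ and the set difference $G\setminus(C_l\cup\{0\})$. For disjoint subsets $P,N$ of $G$, the element $D=P-N$ is a signed set of size $k=|P|+|N|$. For $A=\sum_g a_g g\in\mathbb{Z}[G]$, $A^{-1}=\sum_g a_g g^{-1}$ with $g^{-1}$ the inverse of $g$ in $G$ (i.e. the field element $-g$). $D$ is a $(q,k,\lambda)$-signed difference set if $DD^{-1}=\lambda G+(k-\lambda)\cdot 0_G$ in $\mathbb{Z}[G]$, where $\lambda$ is an integer; it is a signed difference set if this holds for some $\lambda$. *)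

(* Defs.v *)
From HB Require Import structures.
From mathcomp Require Import all_boot all_order all_algebra all_field.

Set Implicit Arguments.
Unset Strict Implicit.
Unset Printing Implicit Defensive.

Import GRing.Theory.
Local Open Scope ring_scope.

(* The integral group ring Z[G] of a finite abelian group G, written
   additively: [A g] is the coefficient of g in A. The alias hides the
   pointwise product of {ffun G -> int}; the product is the convolution. *)
Definition zgroup_ring (G : finZmodType) : Type := {ffun G -> int}.

HB.instance Definition _ (G : finZmodType) :=
  GRing.Zmodule.copy (zgroup_ring G) {ffun G -> int}.

Section GroupRing.
Variable G : finZmodType.
Implicit Types A B C : zgroup_ring G.

Definition zgr_coef A (g : G) : int := (A : {ffun G -> int}) g.

Definition zgr_set (S : {set G}) : zgroup_ring G :=
  [ffun g => ((g \in S) : nat)%:Z].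

Definition zgr_mul A B : zgroup_ring G :=
  [ffun g => \sum_(h : G) zgr_coef A h * zgr_coef B (g - h)].

Definition zgr_inv A : zgroup_ring G := [ffun g => zgr_coef A (- g)].

Lemma zgr_coef_set S g : zgr_coef (zgr_set S) g = ((g \in S) : nat)%:Z.
Proof. by rewrite /zgr_coef ffunE. Qed.

Lemma zgr_coef_mul A B g :
  zgr_coef (zgr_mul A B) g = \sum_(h : G) zgr_coef A h * zgr_coef B (g - h).
Proof. by rewrite /zgr_coef ffunE. Qed.

Lemma zgr_coefD A B g : zgr_coef (A + B) g = zgr_coef A g + zgr_coef B g.
Proof. by rewrite /zgr_coef ffunE. Qed.

Lemma zgrP A B : (forall g, zgr_coef A g = zgr_coef B g) -> A = B.
Proof. by move=> eqAB; apply/ffunP. Qed.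

Lemma zgr_mulC : commutative zgr_mul.
Proof.
move=> A B; apply: zgrP => g; rewrite !zgr_coef_mul.
rewrite (reindex_inj (inj_comp (addrI g) oppr_inj)) /=.
by apply: eq_bigr => h _; rewrite opprD opprK addrA subrr add0r mulrC.
Qed.

Lemma zgr_mulA : associative zgr_mul.
Proof.
move=> A B C; apply: zgrP => g; rewrite !zgr_coef_mul.
under eq_bigr => h _ do rewrite zgr_coef_mul big_distrr /=.
under [RHS]eq_bigr => h _ do rewrite zgr_coef_mul big_distrl /=.
rewrite [RHS]exchange_big; apply: eq_bigr => h _ /=.
rewrite [RHS](reindex_inj (addrI h)) /=; apply: eq_bigr => x _.
by rewrite mulrA opprD addrA [h + x]addrC addrK.
Qed.

Lemma zgr_mul1 : left_id (zgr_set [set 0]) zgr_mul.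
Proof.
move=> A; apply: zgrP => g; rewrite zgr_coef_mul (bigD1 0) //=.
rewrite zgr_coef_set inE eqxx mul1r subr0 big1 ?addr0 // => h h0.
by rewrite zgr_coef_set inE (negPf h0) mul0r.
Qed.

Lemma zgr_mulDl : left_distributive zgr_mul +%R.
Proof.
move=> A B C; apply: zgrP => g; rewrite zgr_coefD !zgr_coef_mul -big_split.
by apply: eq_bigr => h _; rewrite zgr_coefD mulrDl.
Qed.

Lemma zgr1_neq0 : zgr_set [set 0] != 0.
Proof.
apply/eqP => /(congr1 (zgr_coef^~ 0)).
by rewrite zgr_coef_set inE eqxx /zgr_coef ffunE.
Qed.

HB.instance Definition _ := GRing.Zmodule_isComNzRing.Build (zgroup_ring G)
  zgr_mulA zgr_mulC zgr_mul1 zgr_mulDl zgr1_neq0.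

Definition signed_set (k : nat) (D : zgroup_ring G) : Prop :=
  exists P N : {set G},
    [/\ [disjoint P & N], D = zgr_set P - zgr_set N & k = (#|P| + #|N|)%N].

Definition signed_difference_set_of (v k : nat) (lambda : int)
    (D : zgroup_ring G) : Prop :=
  [/\ #|G| = v, signed_set k D
    & D * zgr_inv D =
      zgr_set [set: G] *~ lambda + zgr_set [set 0] *~ (k%:Z - lambda)].

Definition signed_difference_set (D : zgroup_ring G) : Prop :=
  exists (v k : nat) (lambda : int), signed_difference_set_of v k lambda D.

End GroupRing.

Definition cyclotomic_class0 (F : finFieldType) (w : F) (f : nat) : {set F} :=
  [set w ^+ (4 * j) | j : 'I_f].

Definition cyclotomic_class (F : finFieldType) (w : F) (f : nat) (i : 'I_4)
    : {set F} :=
  [set w ^+ i * x | x in cyclotomic_class0 w f].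

(* Main.v *)
(* Write a quartic character as Y + iZ and let rho be the quadratic character;
   put s + iT = sum_x (Y + iZ)(x) rho(1 - x), so that s^2 + T^2 = q. A set of
   signs attached to C_l or to C_l + 0 is a signed difference set iff its
   autocorrelation is constant off 0. Integrality modulo 4 forces f to be odd;
   then Y is odd and rho even, the cross terms cancel, and the autocorrelation is
   a constant plus a multiple of (s - c) rho, with c = 1 for C_l and c = -3 for
   C_l + 0. Hence the condition is s = c, i.e. q = c^2 + T^2. Conversely, for
   q = c^2 + 4 t^2 = p^n, the prime p does not divide s since in F_q the conjugate
   sum s - iT is +-binomial(2f, f); so the representation of q by
   s^2 + 4 (T/2)^2 is unique and s = c, the sign being fixed by s = 1 mod 4.
   Part (3) needs no characters: X = C_i + C_j - C_k - C_l changes sign under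
   multiplication by w or w^2. If X is even, the terms -X(g) - X(-g) of the
   autocorrelation of X - 0 prevent it from being constant. If X is odd, the
   constant must be -1, whereas the autocorrelation is 1 modulo 4. *)

Require Import Defs.
From mathcomp Require Import all_boot all_order all_algebra all_field.
From mathcomp Require Import zify ring lra.

Set Implicit Arguments.
Unset Strict Implicit.
Unset Printing Implicit Defensive.

Import Order.TTheory GRing.Theory Num.Theory.
Local Open Scope ring_scope.

(** * Correlations on a finite abelian group and signed difference sets *)

Definition correlation (G : finZmodType) (u v : G -> int) (g : G) :=
  \sum_h u h * v (h - g).

Lemma sum_mul_delta (G : finZmodType) (u : G -> int) a :
  \sum_h u h * (h == a)%:R = u a.
Proof.
rewrite (bigD1 a) //= eqxx mulr1 big1 ?addr0 // => h /negPf ->.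
by rewrite mulr0.
Qed.

Lemma sum_delta (G : finZmodType) (a : G) : \sum_h (h == a)%:R = 1 :> int.
Proof.
by rewrite -[RHS](sum_mul_delta (fun=> 1) a); apply: eq_bigr => h _; rewrite mul1r.
Qed.

Lemma correlation0 (G : finZmodType) (d : G -> int) :
  (forall x, d x = 1 \/ d x = -1) -> correlation d d 0 = #|G|%:Z.
Proof.
move=> d1; rewrite /correlation -sum1_card -natz natr_sum.
by apply: eq_bigr => h _; rewrite subr0; case: (d1 h) => ->.
Qed.

Lemma sum_correlation (G : finZmodType) (u v : G -> int) :
  \sum_g correlation u v g = (\sum_h u h) * (\sum_h v h).
Proof.
rewrite exchange_big mulr_suml; apply: eq_bigr => h _ /=; rewrite -mulr_sumr.
congr (_ * _); rewrite [RHS](reindex_inj (_ : injective (fun g => h - g))) //.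
by move=> x y /addrI /oppr_inj.
Qed.

(** Put d = 1 - 2b with b valued in {0, 1}: the two linear terms have the same sum, so together they
    give a multiple of 4. This congruence later forces f to be odd and s = 1 mod 4. *)
Lemma correlation_sign_mod4 (G : finZmodType) (d : G -> int) g :
  (forall x, d x = 1 \/ d x = -1) ->
  exists k, correlation d d g = #|G|%:Z + 4 * k.
Proof.
move=> d1; pose b x : int := (d x == -1)%:R.
have dE x : d x = 1 - 2 * b x by rewrite /b; case: (d1 x) => ->.
exists (\sum_h b h * b (h - g) - \sum_h b h).
have shift : \sum_h b (h - g) = \sum_h b h.
  by rewrite [RHS](reindex_inj (addIr (- g))).
transitivity (\sum_h (1 + 4 * (b h * b (h - g)) - 2 * b h - 2 * b (h - g))).
  by apply: eq_bigr => h _; rewrite !dE; ring.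
rewrite !(sumrB, big_split) /= -!mulr_sumr shift sumr_const natz; ring.
Qed.

Lemma zgr_coefB (G : finZmodType) (A B : zgroup_ring G) g :
  zgr_coef (A - B) g = zgr_coef A g - zgr_coef B g.
Proof. by rewrite /zgr_coef !ffunE. Qed.

Lemma zgr_coefMz (G : finZmodType) (A : zgroup_ring G) (m : int) g :
  zgr_coef (A *~ m) g = m * zgr_coef A g.
Proof.
have coefMn n : zgr_coef (A *+ n) g = n%:Z * zgr_coef A g.
  elim: n => [|n IHn]; first by rewrite mul0r /zgr_coef ffunE.
  by rewrite mulrS zgr_coefD IHn; lia.
case: m => n; first exact: coefMn.
have -> : A *~ Negz n = 0 - A *+ n.+1 by rewrite sub0r.
by rewrite zgr_coefB coefMn NegzE /zgr_coef ffunE; lia.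
Qed.

Lemma zgr_coef_autocorrelation (G : finZmodType) (D : zgroup_ring G) g :
  zgr_coef (D * zgr_inv D) g = correlation (zgr_coef D) (zgr_coef D) g.
Proof.
rewrite zgr_coef_mul; apply: eq_bigr => h _.
by rewrite {2}/zgr_coef ffunE opprB.
Qed.

Lemma zgr_coef_lambda (G : finZmodType) (lambda mu : int) (g : G) :
  zgr_coef (zgr_set [set: G] *~ lambda + zgr_set [set 0] *~ mu) g =
  lambda + mu * (g == 0)%:R.
Proof. by rewrite zgr_coefD !zgr_coefMz !zgr_coef_set !inE mulr1 natz. Qed.

(** When all coefficients are 1 or -1, the coefficient at 0 of the product is q = k automatically,
    so only nonzero shifts carry a condition. *)
Lemma signed_difference_set_signP (G : finZmodType) q lambda (D : zgroup_ring G) :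
  #|G| = q -> (forall x, zgr_coef D x = 1 \/ zgr_coef D x = -1) ->
  signed_difference_set_of q q lambda D <->
  forall g, g != 0 -> correlation (zgr_coef D) (zgr_coef D) g = lambda.
Proof.
move=> cardG D1; split=> [[_ _ DD] g /negPf g0 | corrD].
  by rewrite -zgr_coef_autocorrelation DD zgr_coef_lambda g0 mulr0 addr0.
split=> //; last first.
  apply: zgrP => g; rewrite zgr_coef_autocorrelation zgr_coef_lambda.
  have [->|/corrD ->] := eqVneq g 0; last by rewrite mulr0 addr0.
  by rewrite correlation0 // cardG mulr1 addrC subrK.
pose P := [set x | zgr_coef D x == 1]; exists P, (~: P); split.
- by rewrite disjoints_subset setCK.
- apply: zgrP => x; rewrite zgr_coefB !zgr_coef_set !inE.
  by case: (D1 x) => ->.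
- by rewrite cardsC.
Qed.

(** * Sums over a finite field *)

Lemma sum_const_neq0 (F : finFieldType) (V : zmodType) (c : V) :
  \sum_(h : F | h != 0) c = c *+ #|F|.-1.
Proof. by rewrite sumr_const cardC1. Qed.

Lemma sum_antiperiodic (F : finFieldType) (c : F) (u : F -> int) :
  c != 0 -> (forall x, u (c * x) = - u x) -> \sum_x u x = 0.
Proof.
move=> c0 uc; have : \sum_x u x = - \sum_x u x.
  by rewrite -sumrN (reindex_inj (mulfI c0)) /=; apply: eq_bigr.
lia.
Qed.

(* [h |-> 1 - g / h] permutes the field thanks to 1 / 0 = 0. *)
Lemma moebius_inj (F : finFieldType) (g : F) : g != 0 -> injective (fun h : F => 1 - g / h).
Proof. by move=> g0 x y /addrI /oppr_inj /(mulfI g0) /invr_inj. Qed.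

(** As h runs over the nonzero elements, 1 - g / h misses only 1, the image of h = 0. *)
Lemma correlation_moebius (F : finFieldType) (u : F -> int) g : g != 0 ->
  \sum_x u x = 0 -> \sum_(h | h != 0) u (1 - g / h) = - u 1.
Proof.
move=> g0; rewrite (reindex_inj (moebius_inj g0)) (bigD1 0) //= invr0 mulr0 subr0.
by move=> /eqP; rewrite addrC addr_eq0 => /eqP.
Qed.

Lemma moebiusE (F : finFieldType) (g h : F) : h != 0 -> (1 - g / h) * h = h - g.
Proof. by move=> h0; rewrite mulrBl mul1r divfK. Qed.

Lemma mod4_ind (P : nat -> Prop) : P 0%N -> P 1%N -> P 2%N -> P 3%N ->
  forall a, P (a %% 4)%N.
Proof.
move=> P0 P1 P2 P3 a; have := ltn_pmod a (isT : 0 < 4)%N.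
by case: (a %% 4)%N => [|[|[|[|]]]].
Qed.

(** * Quadratic and quartic characters and their Jacobi sum *)

Section QuarticCharacters.

Variables (F : finFieldType) (w : F) (f : nat).
Hypothesis cardF : #|F| = (4 * f + 1)%N.
Hypothesis prim_w : (4 * f).-primitive_root w.

Let f_gt0 : (0 < f)%N.
Proof. by have := prim_order_gt0 prim_w; rewrite muln_gt0. Qed.

Lemma primitive_element_neq0 : w != 0.
Proof.
apply/eqP => w0; have := prim_expr_order prim_w.
by rewrite w0 expr0n muln_eq0 -[(f == 0)%N]negbK -lt0n f_gt0 => /esym/eqP; rewrite oner_eq0.
Qed.

Lemma primitive_root_ind (P : F -> Prop) :
  P 0 -> (forall a, P (w ^+ a)) -> forall x, P x.
Proof.
move=> P0 Pw x; have [-> //|x0] := eqVneq x 0.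
have x1 : x ^+ (4 * f) = 1.
  by apply: (mulfI x0); rewrite -exprS mulr1 -addn1 -cardF expf_card.
by have [a ->] := prim_rootP prim_w x1.
Qed.

Lemma cyclotomic_class_expr a (i : 'I_4) :
  (w ^+ a \in cyclotomic_class w f i) = (a %% 4 == i)%N.
Proof.
apply/imsetP/eqP => [[x /imsetP[j _ ->]] /eqP|ai].
  rewrite -exprD (eq_prim_root_expr prim_w) => /eqP /(congr1 (modn^~ 4)).
  rewrite !modn_dvdm ?dvdn_mulr // => ->.
  by rewrite addnC (mulnC 4) modnMDl modn_small.
have lt_j : ((a %% (4 * f)) %/ 4 < f)%N.
  by rewrite ltn_divLR // mulnC ltn_pmod // muln_gt0 f_gt0.
exists (w ^+ (4 * Ordinal lt_j)); first by apply/imsetP; exists (Ordinal lt_j).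
rewrite -exprD -(prim_expr_mod prim_w a); congr (_ ^+ _).
by rewrite {1}(divn_eq (a %% (4 * f)) 4) modn_dvdm ?dvdn_mulr // ai addnC mulnC.
Qed.

Lemma cyclotomic_class0_notin (i : 'I_4) : (0 \in cyclotomic_class w f i) = false.
Proof.
apply/negP => /imsetP[x /imsetP[j _ ->]] /esym/eqP.
by rewrite -exprD expf_eq0 (negPf primitive_element_neq0) andbF.
Qed.

Definition class_function (phi : nat -> int) (x : F) : int :=
  \sum_(i < 4) phi i * (x \in cyclotomic_class w f i)%:R.

Lemma class_function0 phi : class_function phi 0 = 0.
Proof.
by rewrite /class_function big1 // => i _; rewrite cyclotomic_class0_notin mulr0.
Qed.

Lemma class_function_expr phi a : class_function phi (w ^+ a) = phi (a %% 4)%N.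
Proof.
rewrite /class_function (bigD1 (Ordinal (ltn_pmod a (isT : 0 < 4)%N))) //=.
rewrite cyclotomic_class_expr eqxx mulr1 big1 ?addr0 // => i.
by rewrite cyclotomic_class_expr -val_eqE eq_sym => /negPf /= ->; rewrite mulr0.
Qed.

(** The lists are the values on C_0, ..., C_3: [quartic_re] and [quartic_im] are the real and
    imaginary parts of the character chi with chi(w) = i, and [quadratic_char] is chi^2. *)
Definition quadratic_char := class_function (nth 0 [:: 1; -1; 1; -1]).
Definition quartic_re := class_function (nth 0 [:: 1; 0; -1; 0]).
Definition quartic_im := class_function (nth 0 [:: 0; 1; 0; -1]).

Local Notation rho := quadratic_char.
Local Notation Y := quartic_re.
Local Notation Z := quartic_im.

Let classE :=
  (class_function0, class_function_expr, mul0r, mulr0, subr0, addr0, expr1n).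

Let mod4D a b : (a + b = a %% 4 + b %% 4 %[mod 4])%N.
Proof. by rewrite modnDm. Qed.

Lemma quadratic_charM x y : rho (x * y) = rho x * rho y.
Proof.
rewrite /rho; elim/primitive_root_ind: x => [|a]; first by rewrite !classE.
elim/primitive_root_ind: y => [|b]; first by rewrite !classE.
rewrite -exprD !classE mod4D.
by elim/mod4_ind: (a %% 4)%N; elim/mod4_ind: (b %% 4)%N.
Qed.

Lemma quartic_reM x y : Y (x * y) = Y x * Y y - Z x * Z y.
Proof.
rewrite /Y /Z; elim/primitive_root_ind: x => [|a]; first by rewrite !classE.
elim/primitive_root_ind: y => [|b]; first by rewrite !classE.
rewrite -exprD !classE mod4D.
by elim/mod4_ind: (a %% 4)%N; elim/mod4_ind: (b %% 4)%N.
Qed.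

(** Real part of chi(xy) conj(chi(y)) = chi(x) |chi(y)|^2. *)
Lemma quartic_polar x y :
  Y (x * y) * Y y + Z (x * y) * Z y = Y x * (y != 0)%:R.
Proof.
rewrite /Y /Z; elim/primitive_root_ind: y => [|b]; first by rewrite eqxx /= !classE.
elim/primitive_root_ind: x => [|a]; first by rewrite !classE.
rewrite -exprD !classE mod4D expf_neq0 ?primitive_element_neq0 //.
by elim/mod4_ind: (a %% 4)%N; elim/mod4_ind: (b %% 4)%N.
Qed.

Lemma quadratic_char_quartic_re x : rho x * Y x = Y x.
Proof.
rewrite /rho /Y; elim/primitive_root_ind: x => [|a]; rewrite !classE //.
by elim/mod4_ind: (a %% 4)%N.
Qed.

Lemma quadratic_char_sqr x : rho x * rho x = (x != 0)%:R.
Proof.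
rewrite /rho; elim/primitive_root_ind: x => [|a]; rewrite !classE ?eqxx //.
by rewrite expf_neq0 ?primitive_element_neq0 //; elim/mod4_ind: (a %% 4)%N.
Qed.

Lemma quadratic_char0 : rho 0 = 0. Proof. exact: class_function0. Qed.
Lemma quartic_re0 : Y 0 = 0. Proof. exact: class_function0. Qed.
Lemma quadratic_char1 : rho 1 = 1.
Proof. by rewrite /rho -(expr0 w) classE. Qed.
Lemma quartic_re1 : Y 1 = 1.
Proof. by rewrite /Y -(expr0 w) classE. Qed.

Lemma quadratic_charV x : rho x^-1 = rho x.
Proof.
have [->|x0] := eqVneq x 0; first by rewrite invr0.
have h : rho x * rho x = 1 by rewrite quadratic_char_sqr x0.
by rewrite -[LHS]mulr1 -h mulrA -quadratic_charM mulVf // quadratic_char1 mul1r.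
Qed.

(** Since chi^2 = rho is real, chi(x^2 y) = rho(x) chi(y). *)
Lemma quartic_re_sqrM x y : Y (x * x * y) = rho x * Y y.
Proof.
rewrite /Y /rho; elim/primitive_root_ind: x => [|a]; first by rewrite !classE.
elim/primitive_root_ind: y => [|b]; first by rewrite !classE.
rewrite -!exprD !classE mod4D (mod4D a a).
by elim/mod4_ind: (a %% 4)%N; elim/mod4_ind: (b %% 4)%N.
Qed.

Lemma sum_quadratic_char : \sum_x rho x = 0.
Proof.
apply: (sum_antiperiodic primitive_element_neq0) => x.
by rewrite quadratic_charM {1}/rho -[w]expr1 classE mulN1r.
Qed.

Lemma sum_quartic_re : \sum_x Y x = 0.
Proof.
apply: (sum_antiperiodic (expf_neq0 2 primitive_element_neq0)) => x.
by rewrite quartic_reM {1}/Y {1}/Z !classE mulN1r.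
Qed.

(** For nonzero h, rho(h) rho(h - g) = rho(1 - g / h), and these values sum to - rho(1). *)
Lemma correlation_quadratic_char g : g != 0 -> correlation rho rho g = -1.
Proof.
move=> g0; rewrite /correlation (bigD1 0) //= quadratic_char0 mul0r add0r.
rewrite -[in RHS]quadratic_char1 -(correlation_moebius g0 sum_quadratic_char).
apply: eq_bigr => h h0; rewrite -(moebiusE _ h0) quadratic_charM.
by rewrite mulrCA quadratic_char_sqr h0 mulr1.
Qed.

(** Real and imaginary parts of the Jacobi sum J(chi, rho). *)
Definition jacobi_re := \sum_x Y x * rho (1 - x).
Definition jacobi_im := \sum_x Z x * rho (1 - x).

(** Twice Re(a) Re(b) is Re(a conj(b)) + Re(ab). The first part is summed through 1 - g / h, the
    second becomes a Jacobi sum. *)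
Lemma correlation_quartic_re g : g != 0 ->
  correlation Y Y g *+ 2 = rho g * jacobi_re - 1.
Proof.
move=> g0.
have sum1 : \sum_h (Y h * Y (h - g) + Z h * Z (h - g)) = -1.
  rewrite (bigD1 0) //= {1}/Y {1}/Z !classE add0r.
  rewrite -[in RHS]quartic_re1 -(correlation_moebius g0 sum_quartic_re).
  apply: eq_bigr => h h0; rewrite -(moebiusE _ h0).
  by rewrite mulrC [Z h * _]mulrC quartic_polar h0 mulr1.
have sum2 : \sum_h (Y h * Y (h - g) - Z h * Z (h - g)) = rho g * jacobi_re.
  (* For h = g / (1 - z), h (h - g) = h^2 z, so chi(h (h - g)) = rho(g) rho(1 - z) chi(z). At z = 1
     the convention 1 / 0 = 0 gives h = 0, and both sides vanish. *)
  have inj : injective (fun z : F => g / (1 - z)).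
    by move=> x y /(mulfI g0) /invr_inj /addrI /oppr_inj.
  rewrite (reindex_inj inj) /jacobi_re mulr_sumr; apply: eq_bigr => z _ /=.
  rewrite -quartic_reM mulrBr; set h := g / (1 - z).
  have [z1|z1] := eqVneq z 1.
    have -> : h = 0 by rewrite /h z1 subrr invr0 mulr0.
    by rewrite z1 !mul0r !subrr quartic_re0 quadratic_char0 !mulr0.
  have z1' : 1 - z != 0 by rewrite subr_eq0 eq_sym.
  have -> : h * h - h * g = h * h * z.
    by rewrite -mulrA -mulrBr; congr (h * _);
      rewrite -[X in h - X](divfK z1') -/h mulrBr mulr1 subKr.
  by rewrite quartic_re_sqrM quadratic_charM quadratic_charV; ring.
rewrite -sum2 -sum1 -big_split /correlation mulr2n -big_split /=.
by apply: eq_bigr => h _; ring.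
Qed.

(** J conj(J) is a double sum over y and the ratio z of the two arguments; its inner sum over y is
    an autocorrelation of rho, of order q only at z = 1. *)
Lemma jacobi_norm : jacobi_re ^+ 2 + jacobi_im ^+ 2 = (4 * f + 1)%:Z.
Proof.
(* The final -1 removes the term y = 0. The full sum, after y -> 1 - y, is rho(z) times the
   autocorrelation of rho at 1 - 1/z. *)
have inner z : z != 0 -> \sum_(y | y != 0) rho (1 - z * y) * rho (1 - y) =
    rho z * ((4 * f + 1)%:Z * (z == 1)%:R - 1) - 1.
  move=> z0.
  have -> : \sum_(y | y != 0) rho (1 - z * y) * rho (1 - y) =
      \sum_y rho (1 - z * y) * rho (1 - y) - 1.
    by rewrite [in RHS](bigD1 0) //= mulr0 subr0 quadratic_char1 mulr1 [1 + _]addrC addrK.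
  congr (_ - 1).
  have inj : injective (fun y : F => 1 - y) by move=> x y /addrI /oppr_inj.
  rewrite (reindex_inj inj) /=.
  transitivity (rho z * correlation rho rho (1 - z^-1)).
    rewrite mulr_sumr; apply: eq_bigr => y _; rewrite subKr mulrC.
    rewrite [RHS]mulrCA -[rho z * _]quadratic_charM; congr (rho _ * rho _).
    by field.
  have [->|z1] := eqVneq z 1.
    rewrite invr1 subrr /correlation quadratic_char1 mul1r mulr1.
    under eq_bigr do rewrite subr0 quadratic_char_sqr.
    rewrite (bigD1 0) //= eqxx add0r (eq_bigr (fun=> 1)) => [|y ->//].
    by rewrite sum_const_neq0 cardF mul1r PoszD addrK addn1 natz.
  rewrite correlation_quadratic_char ?mulr0 ?sub0r //.
  by rewrite subr_eq0 eq_sym invr_eq1.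
have -> : jacobi_re ^+ 2 + jacobi_im ^+ 2 =
    \sum_(y | y != 0) \sum_z Y z * (rho (1 - z * y) * rho (1 - y)).
  rewrite !expr2 {2}/jacobi_re {2}/jacobi_im !mulr_sumr -big_split /=.
  rewrite (bigD1 0) //= {1}/Y {1}/Z !classE add0r.
  apply: eq_bigr => y y0; rewrite /jacobi_re /jacobi_im 2!mulr_suml -big_split /=.
  rewrite (reindex_inj (mulIf y0)) /=; apply: eq_bigr => z _.
  have := quartic_polar z y; rewrite y0 mulr1 => <-; ring.
rewrite exchange_big /=.
under eq_bigr do rewrite -mulr_sumr.
transitivity (\sum_z ((4 * f + 1)%:Z * (Y z * (z == 1)%:R) - Y z - Y z)).
  apply: eq_bigr => z _; have [->|z0] := eqVneq z 0; first by rewrite quartic_re0; ring.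
  rewrite inner // mulrBr (mulrA (Y z)) (mulrC (Y z) (rho z)) quadratic_char_quartic_re; ring.
rewrite !sumrB sum_quartic_re -mulr_sumr (bigD1 1) //= eqxx quartic_re1 big1;
  first by rewrite ?subr0 ?addr0 ?mulr1.
by move=> z /negPf ->; rewrite mulr0.
Qed.

Lemma expr_half : w ^+ (2 * f) = -1.
Proof.
have : (w ^+ (2 * f)) ^+ 2 == 1.
  by rewrite -exprM mulnAC (prim_expr_order prim_w).
rewrite sqrf_eq1 => /orP[|/eqP //].
by rewrite -(prim_order_dvd prim_w) gtnNdvd //; move: f_gt0; lia.
Qed.

Lemma opp_expr a : - w ^+ a = w ^+ (2 * f + a).
Proof. by rewrite exprD expr_half mulN1r. Qed.

Lemma quadratic_charN x : rho (- x) = rho x.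
Proof.
rewrite /rho; elim/primitive_root_ind: x => [|a]; first by rewrite oppr0.
rewrite opp_expr !classE mod4D.
have : (2 * f %% 4 = 0 \/ 2 * f %% 4 = 2)%N by lia.
by case=> ->; elim/mod4_ind: (a %% 4)%N.
Qed.

(** -1 = w^(2f) lies in C_2 when f is odd. *)
Lemma quartic_reN x : odd f -> Y (- x) = - Y x.
Proof.
move=> odd_f; rewrite /Y; elim/primitive_root_ind: x => [|a].
  by rewrite oppr0 !classE.
rewrite opp_expr !classE mod4D.
have -> : (2 * f %% 4 = 2)%N by lia.
by elim/mod4_ind: (a %% 4)%N.
Qed.

(** Here 2d = u - 2Y with u even and Y odd, so the cross correlations cancel. The constant c encodes
    the value d(0) = (1 + c) / 2. *)
Lemma correlation_sum_quartic (c : int) (d : F -> int) g : odd f -> g != 0 ->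
  (forall x, d x *+ 2 = 1 + c * (x == 0)%:R - rho x - Y x *+ 2) ->
  correlation d d g *+ 4 = (4 * f + 1)%:Z - 3 + c *+ 2 + (rho g * (jacobi_re - c)) *+ 2.
Proof.
move=> odd_f g0 dE; pose u x := 1 + c * (x == 0)%:R - rho x.
have uN x : u (- x) = u x by rewrite /u quadratic_charN oppr_eq0.
have cross : correlation Y u g = - correlation u Y g.
  have inj : injective (fun h : F => g - h) by move=> x y /addrI /oppr_inj.
  rewrite /correlation (reindex_inj inj) -sumrN; apply: eq_bigr => h _ /=.
  by rewrite addrAC subrr add0r uN -opprB quartic_reN // mulNr mulrC.
have uu : correlation u u g = (4 * f + 1)%:Z - 1 + c *+ 2 - (c * rho g) *+ 2.
  have sum_shift : \sum_h rho (h - g) = 0.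
    by rewrite -[RHS]sum_quadratic_char [RHS](reindex_inj (addIr (- g))).
  transitivity (\sum_h (1 + c * (h == 0)%:R + c * (h == g)%:R
    + (c ^+ 2 * (h - g == 0)%:R) * (h == 0)%:R - rho h - c * (rho h * (h == g)%:R)
    - rho (h - g) - c * (rho (h - g) * (h == 0)%:R) + rho h * rho (h - g))).
    by apply: eq_bigr => h _; rewrite /u subr_eq0; ring.
  rewrite !(sumrB, big_split) /= -!mulr_sumr !sum_mul_delta !sum_delta.
  rewrite sum_quadratic_char sum_shift.
  rewrite -/(correlation rho rho g) correlation_quadratic_char //.
  rewrite sumr_const cardF sub0r oppr_eq0 (negPf g0) quadratic_charN natz mulr0; ring.
have -> : correlation d d g *+ 4 =
    correlation u u g + (correlation Y Y g *+ 2) *+ 2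
    - (correlation Y u g + correlation u Y g) *+ 2.
  rewrite /correlation -!sumrMnl -!big_split -!sumrMnl -sumrB /=.
  apply: eq_bigr => h _.
  transitivity ((d h *+ 2) * (d (h - g) *+ 2)); first by ring.
  by rewrite !dE -/(u h) -/(u (h - g)); ring.
rewrite uu correlation_quartic_re // cross; ring.
Qed.

(** * Power sums in F and the Jacobi sum modulo the characteristic *)

Lemma sum_expr_ndvd k : ~~ (4 * f %| k)%N -> \sum_(x : F) x ^+ k = 0.
Proof.
rewrite (prim_order_dvd prim_w) => wk.
have : (1 - w ^+ k) * \sum_(x : F) x ^+ k = 0.
  rewrite mulrBl mul1r {1}(reindex_inj (mulfI primitive_element_neq0)) /= mulr_sumr -sumrB.
  by rewrite big1 // => x _; rewrite exprMn subrr.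
by move/eqP; rewrite mulf_eq0 subr_eq0 eq_sym (negPf wk) => /eqP.
Qed.

(** Translation by 1 preserves the sum of all elements, yet adds [#|F|] times 1 to it. *)
Lemma card_field_eq0 : (4 * f + 1)%:R = 0 :> F.
Proof.
apply: (addrI (\sum_(x : F) x)); rewrite addr0 [in RHS](reindex_inj (addIr 1)) /=.
by rewrite big_split /= sumr_const cardF.
Qed.

Lemma sum_expr_order : \sum_(x : F) x ^+ (4 * f) = -1.
Proof.
rewrite (bigD1 0) //= expr0n; have -> : (4 * f == 0)%N = false by lia.
rewrite add0r (eq_bigr (fun=> 1)) => [|x]; last first.
  elim/primitive_root_ind: x => [/eqP //|a _].
  by rewrite -exprM mulnC exprM (prim_expr_order prim_w) expr1n.
rewrite sum_const_neq0 cardF addn1 /=.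
by apply/eqP; rewrite -addr_eq0 natr1 -addn1 card_field_eq0.
Qed.

Let iota2 : w ^+ f * w ^+ f = -1.
Proof. by rewrite -exprD -expr_half; congr (_ ^+ _); lia. Qed.

Let iota_expr a : w ^+ f ^+ a = w ^+ f ^+ (a %% 4).
Proof.
have iota4 : w ^+ f ^+ 4 = 1 by rewrite -exprM mulnC (prim_expr_order prim_w).
by rewrite {1}(divn_eq a 4) exprD mulnC exprM iota4 expr1n mul1r.
Qed.

Lemma quadratic_char_intr x : (rho x)%:~R = x ^+ (2 * f) :> F.
Proof.
rewrite /rho; elim/primitive_root_ind: x => [|a].
  by rewrite classE expr0n muln_eq0 -[(f == 0)%N]negbK -lt0n f_gt0.
rewrite classE -exprM mulnA mulnC exprM (iota_expr (a * 2)).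
rewrite -modnMml.
by elim/mod4_ind: (a %% 4)%N; rewrite /= ?exprS ?expr0 ?mulr1 ?iota2.
Qed.

(** [w ^+ f] plays the role of i in F, and the conjugate of i is i^3; hence the exponent 3f. *)
Lemma quartic_intr x : (Y x)%:~R - w ^+ f * (Z x)%:~R = x ^+ (3 * f) :> F.
Proof.
rewrite /Y /Z; elim/primitive_root_ind: x => [|a].
  by rewrite !classE expr0n muln_eq0 -[(f == 0)%N]negbK -lt0n f_gt0.
rewrite !classE -exprM mulnA mulnC exprM (iota_expr (a * 3)).
rewrite -modnMml.
have i3 : w ^+ f ^+ 3 = - w ^+ f by rewrite exprS expr2 iota2 mulrN1.
elim/mod4_ind: (a %% 4)%N; rewrite /= ?i3 ?expr2 ?iota2 ?expr0 ?expr1; ring.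
Qed.

(** The conjugate sum becomes the sum of x^(3f) (1 - x)^(2f). In its binomial expansion only the
    power sum of exponent 4f survives, that is, the index i = f. *)
Lemma jacobi_intr :
  jacobi_re%:~R - w ^+ f * jacobi_im%:~R = - ((-1) ^+ f * 'C(2 * f, f)%:R) :> F.
Proof.
transitivity (\sum_(x : F) x ^+ (3 * f) * (1 - x) ^+ (2 * f)).
  rewrite !rmorph_sum mulr_sumr -sumrB; apply: eq_bigr => x _ /=.
  by rewrite !intrM quadratic_char_intr -quartic_intr; ring.
transitivity (\sum_(i < (2 * f).+1) (-1) ^+ i * 'C(2 * f, i)%:R *
               \sum_(x : F) x ^+ (3 * f + i)).
  under [RHS]eq_bigr do rewrite mulr_sumr.
  rewrite exchange_big; apply: eq_bigr => x _ /=.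
  rewrite exprBn mulr_sumr; apply: eq_bigr => i _.
  by rewrite expr1n mulr1 exprD -mulr_natr; ring.
have lt_f : (f < (2 * f).+1)%N by lia.
rewrite (bigD1 (Ordinal lt_f)) //= -mulSnr sum_expr_order mulrN1 big1 ?addr0 // => i.
rewrite -val_eqE /= => i_f; rewrite sum_expr_ndvd ?mulr0 //.
(* Since 3f + i lies between 3f and 5f, it can be a multiple of 4f only for i = f. *)
apply/negP => /dvdnP[[|[|k]]]; have := ltn_ord i; move/eqP: i_f; move: f_gt0; nia.
Qed.

(** If p divided s, then s^2 + T^2 = q would make T vanish in F, hence also the conjugate sum and
    the binomial coefficient. *)
Lemma jacobi_re_ndvd p : p \in [pchar F] -> ~~ (p %| 'C(2 * f, f))%N ->
  ~~ (p %| jacobi_re)%Z.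
Proof.
move=> pF; rewrite (dvdn_pcharf pF) (dvdz_pcharf pF); apply: contra => /eqP re0.
have im0 : jacobi_im%:~R = 0 :> F.
  have /(congr1 (intr : int -> F)) := jacobi_norm.
  rewrite -pmulrn card_field_eq0 rmorphD !rmorphXn /= re0 expr0n add0r => /eqP.
  by rewrite expf_eq0 => /eqP.
have /esym/eqP := jacobi_intr.
by rewrite re0 im0 mulr0 subr0 oppr_eq0 mulf_eq0 signr_eq0.
Qed.

End QuarticCharacters.

(** * Binomial coefficients, prime powers and sums of two squares *)

(* Base [p] additions [f + f] have no carries, as all digits of [f] equal
   [(p - 1) / 4]. *)
Lemma central_binomial_ndvd p n f : prime p -> (p %% 4 = 1)%N ->
  (4 * f + 1 = p ^ n)%N -> ~~ (p %| 'C(2 * f, f))%N.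
Proof.
move=> p_pr p4 fE.
have pX4 k : (p ^ k %% 4 = 1)%N by rewrite -modnXm p4 exp1n.
have div_pX k : ((2 * f) %/ p ^ k = 2 * (f %/ p ^ k))%N.
  have pk_gt0 : (0 < p ^ k)%N by rewrite expn_gt0 prime_gt0.
  have [le_kn|lt_nk] := leqP k n; last first.
    have : (p ^ n <= p ^ k)%N by rewrite leq_pexp2l ?prime_gt0 // ltnW.
    by rewrite -fE => le_f; rewrite !divn_small //; lia.
  (* With p^k = P = 4b + 1 and p^(n - k) = 4a + 1, f = aP + b and 2b < P, so doubling f exactly
     doubles its quotient by P. *)
  have {}fE : (4 * f + 1 = p ^ (n - k) * p ^ k)%N by rewrite -expnD subnK.
  have := pX4 (n - k)%N; have := pX4 k.
  move: (p ^ k)%N (p ^ (n - k))%N pk_gt0 fE => P Q P_gt0 fE P4 Q4.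
  move: (divn_eq Q 4) (divn_eq P 4) fE; rewrite Q4 P4.
  move: (Q %/ 4)%N (P %/ 4)%N => a b -> PE fE.
  have -> : (f = a * P + b)%N by rewrite PE in fE *; lia.
  by rewrite mulnDr mulnA !divnMDl // !divn_small ?addn0 //; lia.
apply/negP => p_dvd.
(* Legendre's formula; the terms with k > f vanish because f < p^k. *)
have : logn p (2 * f)`! = (2 * logn p f`!)%N.
  rewrite !logn_fact // (big_cat_nat (n := f.+1)) //=; last by lia.
  rewrite [X in (_ + X)%N]big_nat_cond [X in (_ + X)%N]big1 => [|k]; last first.
    rewrite andbT => /andP[lt_fk _]; rewrite div_pX divn_small //.
    by apply: leq_trans (ltnW _) (ltn_expl _ (prime_gt1 p_pr)); lia.
  by rewrite addn0 big_distrr /=; apply: eq_bigr => k _; rewrite div_pX.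
have le_f : (f <= 2 * f)%N by lia.
have C_gt0 : (0 < 'C(2 * f, f))%N by rewrite bin_gt0.
rewrite -(bin_fact le_f) (_ : 2 * f - f = f)%N; last by lia.
rewrite !lognM ?muln_gt0 ?fact_gt0 //.
have : (0 < logn p 'C(2 * f, f))%N by rewrite logn_gt0 mem_primes p_pr C_gt0.
lia.
Qed.

(** Odd squares are 1 mod 8, so p^n is 1 or p mod 8. *)
Lemma prime_power_mod8 p n : prime p -> (p ^ n %% 8 = 5)%N -> (p %% 8 = 5)%N.
Proof.
move=> p_pr pn5.
have odd_p : odd p.
  case: n pn5 => // n pn5; have : odd (p ^ n.+1) by lia.
  by rewrite oddX.
have p2 : (p ^ 2 %% 8 = 1)%N.
  rewrite -modnXm; have : odd (p %% 8) by lia.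
  by have := ltn_pmod p (isT : 0 < 8)%N; case: (p %% 8)%N => [|[|[|[|[|[|[|[|]]]]]]]].
move: pn5; rewrite -(odd_double_half n) -mul2n expnD expnM -modnMmr -modnXm p2 exp1n.
by case: (odd n) => //=; rewrite muln1.
Qed.

(** The prime power p^n divides (ad - bc)(ad + bc) while p cannot divide both factors, so p^n
    divides one of them. Composing the two representations bounds that factor and forces it to be
    0. *)
Lemma sum_two_squares_uniq (p n : nat) (a b c d : int) :
  prime p -> odd p -> (0 < n)%N ->
  a ^+ 2 + 4 * b ^+ 2 = (p ^ n)%:Z -> c ^+ 2 + 4 * d ^+ 2 = (p ^ n)%:Z ->
  ~~ (p %| a)%Z -> ~~ (p %| c)%Z -> a ^+ 2 = c ^+ 2.
Proof.
move=> p_pr odd_p n_gt0 ab cd pa pc.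
have q_gt0 : 0 < (p ^ n)%:Z by rewrite ltz_nat expn_gt0 prime_gt0.
have EuclidZ (x y : int) : (p %| x * y)%Z = (p %| x)%Z || (p %| y)%Z.
  by rewrite !dvdzE abszM /= Euclid_dvdM.
have coprimeZ (x : int) : ~~ (p %| x)%Z -> coprimez (p ^ n)%:Z x.
  by rewrite coprimezE dvdzE /= => px; rewrite coprimeXl // prime_coprime.
have p2 : ~~ (p %| 2%:Z)%Z.
  by rewrite dvdzE /= dvdn_prime2 //; apply: contraTN odd_p => /eqP ->.
have p_q : (p %| (p ^ n)%:Z)%Z by rewrite dvdzE /= dvdn_exp.
have key : 4 * ((a * d - b * c) * (a * d + b * c)) =
    (a ^+ 2 - c ^+ 2) * (p ^ n)%:Z.
  have e1 : 4 * b ^+ 2 = (p ^ n)%:Z - a ^+ 2 by rewrite -ab; ring.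
  have e2 : 4 * d ^+ 2 = (p ^ n)%:Z - c ^+ 2 by rewrite -cd; ring.
  transitivity (a ^+ 2 * (4 * d ^+ 2) - c ^+ 2 * (4 * b ^+ 2)); first by ring.
  by rewrite e1 e2; ring.
(* A nonzero multiple y of p^n would give 4 y^2 > (p^n)^2. *)
have vanish (x y : int) : x ^+ 2 + 4 * y ^+ 2 = (p ^ n)%:Z ^+ 2 ->
    ((p ^ n)%:Z %| y)%Z -> y = 0.
  move=> xy /dvdzP[m yE]; move: xy; rewrite {}yE.
  have [-> _|m0] := eqVneq m 0; first exact: mul0r.
  have m2 : 1 <= m ^+ 2 by rewrite -gtz0_ge1 exprn_even_gt0.
  have q2 : 0 < (p ^ n)%:Z ^+ 2 by rewrite exprn_gt0.
  rewrite exprMn; have := ler_peMl (ltW q2) m2; have := sqr_ge0 x; move: q2.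
  by move: ((p ^ n)%:Z ^+ 2) (m ^+ 2 * _) (x ^+ 2); clear; lia.
have eq0 : (a * d - b * c) * (a * d + b * c) = 0.
  have q_dvd : ((p ^ n)%:Z %| (a * d - b * c) * (a * d + b * c))%Z.
    rewrite -(@Gauss_dvdzr _ 4) ?key ?dvdz_mull //.
    by rewrite (_ : 4 = 2%:Z * 2) // coprimezMr coprimeZ.
  have [p_minus|p_minus] := boolP (p %| a * d - b * c)%Z; last first.
    (* Brahmagupta's identity: the product of the two forms is (ac - 4bd)^2 + 4 (ad + bc)^2. *)
    rewrite (vanish (a * c - 4 * b * d) (a * d + b * c)) ?mulr0 //.
      transitivity ((a ^+ 2 + 4 * b ^+ 2) * (c ^+ 2 + 4 * d ^+ 2)); first by ring.
      by rewrite ab cd expr2.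
    by rewrite -(Gauss_dvdzr _ (coprimeZ _ p_minus)).
  have p_plus : ~~ (p %| a * d + b * c)%Z.
    (* The factors add up to 2ad, so p would divide d and then c^2. *)
    apply/negP => p_plus; have := rpredD p_minus p_plus.
    rewrite (_ : a * d - b * c + (a * d + b * c) = 2 * (a * d)); last by ring.
    rewrite !EuclidZ (negPf p2) (negPf pa) /= => pd.
    have : (p %| c ^+ 2)%Z.
      rewrite (_ : c ^+ 2 = (p ^ n)%:Z - 4 * d * d); last by rewrite -cd; ring.
      by rewrite rpredB // dvdz_mull.
    by rewrite expr2 EuclidZ (negPf pc).
  rewrite (vanish (a * c + 4 * b * d) (a * d - b * c)) ?mul0r //.
    transitivity ((a ^+ 2 + 4 * b ^+ 2) * (c ^+ 2 + 4 * d ^+ 2)); first by ring.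
      by rewrite ab cd expr2.
  by rewrite -(Gauss_dvdzl _ (coprimeZ _ p_plus)).
have : (a ^+ 2 - c ^+ 2) * (p ^ n)%:Z = 0 by rewrite -key eq0 mulr0.
move/eqP; rewrite mulf_eq0 (gt_eqF q_gt0) orbF subr_eq0 => /eqP //.
Qed.

(** * Sign functions of a cyclotomic class *)

(* [z = 0] gives the signs of [G - 2 C_l] and [z = 1] those of
   [G - 2 (C_l + 0)]. *)
Definition class_sign (F : finFieldType) (w : F) (f : nat) (z : bool) (l : 'I_4)
    (x : F) : int :=
  1 - 2 * (x \in cyclotomic_class w f l)%:R - 2 * z%:R * (x == 0)%:R.

Section ClassSign.

Variables (F : finFieldType) (w : F) (p n f : nat).
Hypotheses (p_pr : prime p) (cardF : #|F| = (4 * f + 1)%N).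
Hypotheses (prim_w : (4 * f).-primitive_root w) (fE : (4 * f + 1 = p ^ n)%N).

Local Notation s := (jacobi_re w f).

Lemma class_sign_pm z l x :
  class_sign w f z l x = 1 \/ class_sign w f z l x = -1.
Proof.
rewrite /class_sign; have [->|x0] := eqVneq x 0.
  by rewrite cyclotomic_class0_notin //; case: z; [right | left].
by case: (_ \in _); rewrite !mulr0; [right | left].
Qed.

(** Multiplication by w^l maps C_0 onto C_l; this reduces the autocorrelations to the case l = 0. *)
Lemma class_sign_shift z l x : class_sign w f z l (w ^+ l * x) = class_sign w f z ord0 x.
Proof.
have wl0 : w ^+ l != 0 by rewrite expf_neq0 ?(primitive_element_neq0 prim_w).
rewrite /class_sign mulf_eq0 (negPf wl0) /=; congr (1 - 2 * _%:R - _).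
elim/(primitive_root_ind cardF prim_w): x => [|a].
  by rewrite mulr0 !cyclotomic_class0_notin.
rewrite -exprD !(cyclotomic_class_expr prim_w) /=.
have := ltn_ord l; lia.
Qed.

(** Off 0 the indicator of C_0 is (1 + rho + 2Y) / 4. This is the shape required by
    [correlation_sum_quartic], with c = 1 - 4z. *)
Lemma class_sign_quartic z x :
  class_sign w f z ord0 x *+ 2 = 1 + (1 - 4 * z%:R) * (x == 0)%:R
    - quadratic_char w f x - quartic_re w f x *+ 2.
Proof.
rewrite /class_sign /quadratic_char /quartic_re.
elim/(primitive_root_ind cardF prim_w): x => [|a].
  by rewrite !(class_function0 prim_w) eqxx cyclotomic_class0_notin //; case: z.
have w0 : w ^+ a != 0 by rewrite expf_neq0 ?(primitive_element_neq0 prim_w).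
rewrite !(class_function_expr prim_w) (cyclotomic_class_expr prim_w) (negPf w0) !mulr0.
by elim/mod4_ind: (a %% 4)%N.
Qed.

Lemma jacobi_re_mod4 : odd f -> exists m, s = 1 + 4 * m.
Proof.
move=> odd_f; have [k E] := correlation_sign_mod4 1 (class_sign_pm false ord0).
have := correlation_sum_quartic cardF prim_w odd_f (oner_neq0 F)
  (class_sign_quartic false).
rewrite quadratic_char1 // E cardF.
(* The formula with c = 1 gives s = 6f + 3 + 8k, where f = 2 (f %/ 2) + 1. *)
by exists ((f %/ 2)%N%:Z * 3 + 2 + 2 * k); lia.
Qed.

Lemma jacobi_im_even : odd f -> exists t, jacobi_im w f = 2 * t.
Proof.
move=> odd_f; have [m sE] := jacobi_re_mod4 odd_f.
have := jacobi_norm cardF prim_w; rewrite sE => norm.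
have := divz_eq (jacobi_im w f) 2; have := modz_ge0 (jacobi_im w f) (isT : 2%:Z != 0).
have := ltz_pmod (jacobi_im w f) (isT : 0 < 2%:Z).
move: (jacobi_im w f %/ 2)%Z (jacobi_im w f %% 2)%Z => t r r_lt r_ge TE.
exists t; suff : r <> 1 by lia.
move=> r1; rewrite r1 in TE; rewrite TE in norm; lia.
Qed.

Lemma class_sign_correlation_constP (z : bool) (l : 'I_4) :
  (forall g, g != 0 -> correlation (class_sign w f z l) (class_sign w f z l) g =
     f%:Z - z%:R * 2) <->
  exists t : int, ~~ (2 %| t)%Z /\ (4 * f + 1)%:Z = 4 * t ^+ 2 + 1 + z%:R * 8.
Proof.
have wl0 : w ^+ l != 0 by rewrite expf_neq0 ?(primitive_element_neq0 prim_w).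
have shift g : correlation (class_sign w f z l) (class_sign w f z l) (w ^+ l * g) =
    correlation (class_sign w f z ord0) (class_sign w f z ord0) g.
  rewrite /correlation (reindex_inj (mulfI wl0)); apply: eq_bigr => h _ /=.
  by rewrite -mulrBr !class_sign_shift.
have formula (odd_f : odd f) g (g0 : g != 0) :=
  correlation_sum_quartic cardF prim_w odd_f g0 (class_sign_quartic z).
split=> [const | [t [t_odd tE]]].
  have E1 : correlation (class_sign w f z ord0) (class_sign w f z ord0) 1 =
      f%:Z - z%:R * 2.
    by rewrite -shift const // mulf_neq0 ?oner_neq0.
  have [k] := correlation_sign_mod4 1 (class_sign_pm z ord0).
  rewrite E1 cardF => E4.
  (* Both f - 2z and 4f + 1 are the autocorrelation mod 4, so f = 1 + 2z mod 4. *)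
  have odd_f : odd f by case: z {const shift formula E1} E4; lia.
  have := formula odd_f 1 (oner_neq0 F); rewrite E1 quadratic_char1 // => Es.
  have {Es} sE : s = 1 - 4 * z%:R by lia.
  have [t TE] := jacobi_im_even odd_f.
  have := jacobi_norm cardF prim_w; rewrite sE TE => norm.
  exists t; split; last by case: (z) norm; lia.
  (* An even t would give 4f + 1 = c^2 mod 16 with c^2 = 1 + 8z, hence an even f. *)
  apply/negP => /dvdzP[m tm]; rewrite tm in norm.
  by case: (z) norm; lia.
have {t_odd} [m tm] : exists m, t = 2 * m + 1 by exists (t %/ 2)%Z; lia.
have odd_f : odd f by rewrite tm in tE; case: (z) tE; lia.
have p8 : (p %% 8 = 5)%N.
  by apply: (@prime_power_mod8 _ n) => //; rewrite -fE; lia.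
have [k sE] := jacobi_re_mod4 odd_f.
have [u TE] := jacobi_im_even odd_f.
have pF : p \in [pchar F] by apply: (@card_finPcharP _ _ n); rewrite // cardF.
(* Both s^2 + 4u^2 and c^2 + 4t^2 represent q; p does not divide c, which is 1 or -3, because p = 5
   mod 8. *)
have s2 : s ^+ 2 = (1 - 4 * z%:R) ^+ 2.
  apply: (@sum_two_squares_uniq p n _ u _ t) => //.
  - by lia.
  - by case: n fE => //; rewrite expn0; lia.
  - by rewrite -fE -(jacobi_norm cardF prim_w) TE; ring.
  - by rewrite -fE tE; case: (z); lia.
  - apply: (jacobi_re_ndvd cardF prim_w) => //.
    by apply: (@central_binomial_ndvd _ n) => //; lia.
  - rewrite dvdzE; case: (z) => /=; last by rewrite dvdn1; lia.
    by rewrite dvdn_prime2 //; lia.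
(* The other root s = -c is -1 or 3, contrary to s = 1 mod 4. *)
have {s2 sE} sE : s = 1 - 4 * z%:R.
  move/eqP: s2; rewrite eqf_sqr => /orP[] /eqP; rewrite ?sE //.
  by case: (z); lia.
move=> g g0; have -> : g = w ^+ l * (w ^- l * g) by rewrite mulVKf.
have := formula odd_f (w ^- l * g); rewrite shift sE subrr mulr0 => corr4.
have : w ^- l * g != 0 by rewrite mulf_neq0 ?invr_eq0.
move/corr4; lia.
Qed.

End ClassSign.

(** * Sign functions negated by a multiplication *)

Lemma antiperiodic_not_sds (F : finFieldType) (f : nat) (u : F) (X : F -> int)
    (D : zgroup_ring F) :
  #|F| = (4 * f + 1)%N -> u != 0 -> X 0 = 0 ->
  (forall x, x != 0 -> X x = 1 \/ X x = -1) ->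
  (forall x, X (u * x) = - X x) ->
  (forall x, X (- x) = X x) \/ (forall x, X (- x) = - X x) ->
  (forall x, zgr_coef D x = X x - (x == 0)%:R) ->
  ~ signed_difference_set D.
Proof.
move=> cardF u0 X0 X1 Xu XN DE [v [k [lambda [_ _ DD]]]].
have coefDD g : g != 0 -> correlation (zgr_coef D) (zgr_coef D) g = lambda.
  by move=> /negPf g0; rewrite -zgr_coef_autocorrelation DD zgr_coef_lambda g0
    mulr0 addr0.
have corrD g : g != 0 -> correlation X X g - X (- g) - X g = lambda.
  move=> g0; rewrite -(coefDD g g0).
  transitivity (\sum_h (X h * X (h - g) - X (h - g) * (h == 0)%:R
      - X h * (h == g)%:R + (h - g == 0)%:R * (h == 0)%:R)).
    rewrite big_split !sumrB /= !sum_mul_delta sub0r oppr_eq0 (negPf g0) addr0.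
    by rewrite -/(correlation X X g).
  by apply: eq_bigr => h _; rewrite !DE subr_eq0; ring.
case: XN => XN.
  (* For even X, the autocorrelation of X agrees at 1 and u, while the extra term -2X changes
     sign. *)
  have corr_u : correlation X X (u * 1) = correlation X X 1.
    rewrite /correlation (reindex_inj (mulfI u0)); apply: eq_bigr => h _ /=.
    by rewrite -mulrBr !Xu mulrNN.
  have u10 : u * 1 != 0 by rewrite mulr1.
  have := corrD _ u10; have := corrD _ (oner_neq0 F).
  rewrite corr_u !XN Xu; move: (correlation X X 1) => M.
  by case: (X1 _ (oner_neq0 F)) => ->; lia.
have sumX : \sum_x X x = 0 by exact: (sum_antiperiodic u0 Xu).
have DX x : zgr_coef D x = 1 \/ zgr_coef D x = -1.
  rewrite DE; have [->|x0] := eqVneq x 0; first by rewrite X0; right.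
  by rewrite subr0; apply: X1.
have sumD : \sum_x zgr_coef D x = -1.
  rewrite (eq_bigr _ (fun x _ => DE x)) sumrB sumX.
  by rewrite sum_delta.
(* Summing the autocorrelation over all shifts gives 1 = q + 4f lambda. *)
have lambda1 : lambda = -1.
  have := sum_correlation (zgr_coef D) (zgr_coef D); rewrite sumD.
  rewrite (bigD1 0) //= correlation0 // cardF (eq_bigr (fun=> lambda) coefDD).
  rewrite sum_const_neq0 cardF addn1 /=.
  have f0 : (f != 0)%N.
    by apply/eqP => f0; have := finNzRing_gt1 F; rewrite cardF f0.
  rewrite -mulr_natr natz => E.
  have /eqP : (4 * f)%:Z * (lambda + 1) = 0 by lia.
  by rewrite mulf_eq0 addr_eq0 eqz_nat muln_eq0 (negPf f0) => /eqP.
(* With b the indicator of X = 1, 1 + X = 2b off 0. As X is odd, the exceptional terms h = 0 and h =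
   1 add up to 2. *)
have [m corr4] : exists m, correlation X X 1 = 1 + 4 * m.
  pose b x : int := (X x == 1)%:R.
  have XE x : x != 0 -> 1 + X x = 2 * b x.
    by move=> /X1; rewrite /b; case=> ->.
  exists (\sum_(h | (h != 0) && (h != 1)) b h * b (h - 1) - f%:Z).
  have : \sum_h (1 + X h) * (1 + X (h - 1)) =
      2 + 4 * \sum_(h | (h != 0) && (h != 1)) b h * b (h - 1).
    rewrite (bigD1 0) //= (bigD1 1) ?oner_neq0 //= subrr sub0r X0 XN mulr_sumr.
    rewrite addrA; congr (_ + _); first by ring.
    apply: eq_bigr => h /andP[h0 h1]; rewrite !XE ?subr_eq0 //; ring.
  have -> : \sum_h (1 + X h) * (1 + X (h - 1)) = (4 * f + 1)%:Z + correlation X X 1.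
    transitivity (\sum_h (1 + X h + X (h - 1) + X h * X (h - 1))).
      by apply: eq_bigr => h _; ring.
    rewrite !big_split /= sumX sumr_const cardF natz.
    have -> : \sum_h X (h - 1) = 0.
      by rewrite -[RHS]sumX [RHS](reindex_inj (addIr (- 1))).
    by rewrite !addr0.
  lia.
have := corrD _ (oner_neq0 F); rewrite corr4 XN; lia.
Qed.

(** * The four families of signed sets *)

Theorem proposition5p3 (q f : nat) (F : finFieldType) (w : F)
  (q_prime_power : exists p n : nat, [/\ prime p, (0 < n)%N & q = (p ^ n)%N])
  (q_mod4 : q = 1 %[mod 4])
  (q_eq : q = (4 * f + 1)%N)
  (cardF : #|F| = q)
  (w_primitive : q.-1.-primitive_root w) :
  let G : zgroup_ring F := zgr_set [set: F] in
  let O : zgroup_ring F := zgr_set [set 0] in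
  let C (i : 'I_4) : zgroup_ring F := zgr_set (cyclotomic_class w f i) in
  [/\
    let P := G - O in
    let N := O in
    signed_difference_set_of q q (q%:Z - 4) (P - N),
    forall l : 'I_4,
      let P := G - C l - O in
      let N := C l + O in
      signed_difference_set_of q q ((q%:Z - 9) %/ 4)%Z (P - N) <->
      exists t : int, ~~ (2 %| t)%Z /\ q%:Z = 4 * t ^+ 2 + 9,
    forall i j k l : 'I_4, [set i; j; k; l] = [set: 'I_4] ->
      let P := C i + C j in
      let N := C k + C l + O in
      ~ signed_difference_set (P - N)
  & forall l : 'I_4,
      let P := C l in
      let N := G - C l in
      signed_difference_set_of q q ((q%:Z - 1) %/ 4)%Z (P - N) <->
      exists t : int, ~~ (2 %| t)%Z /\ q%:Z = 4 * t ^+ 2 + 1].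
Proof.
move=> G O C; have [p [n [p_pr n_gt0 qE]]] := q_prime_power.
have cardF4 : #|F| = (4 * f + 1)%N by rewrite cardF.
have prim_w : (4 * f).-primitive_root w by rewrite q_eq addn1 in w_primitive.
have fE : (4 * f + 1 = p ^ n)%N by rewrite -q_eq.
have coefG x : zgr_coef G x = 1 by rewrite zgr_coef_set inE.
have coefO x : zgr_coef O x = (x == 0)%:R by rewrite zgr_coef_set inE natz.
have coefC i x : zgr_coef (C i) x = (x \in cyclotomic_class w f i)%:R.
  by rewrite zgr_coef_set natz.
have coefE := (zgr_coefB, zgr_coefD, coefG, coefO, coefC).
split.
- pose d (x : F) : int := 1 - 2 * (x == 0)%:R.
  have dE : zgr_coef (G - O - O) =1 d by move=> x; rewrite !coefE /d; ring.
  apply/signed_difference_set_signP => // [x|g g0].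
    by rewrite dE /d; case: (x == 0); [right | left].
  (* The last term vanishes because g is nonzero, which leaves q - 2 - 2. *)
  transitivity (\sum_h (1 - 2 * (h == 0)%:R - 2 * (h == g)%:R
      + (4 * (h == g)%:R) * (h == 0)%:R) : int).
    by apply: eq_bigr => h _; rewrite !dE /d subr_eq0; ring.
  rewrite big_split !sumrB /= -!mulr_sumr !sum_delta sum_mul_delta.
  by rewrite sumr_const cardF natz eq_sym (negPf g0); lia.
- move=> l P N; rewrite (signed_difference_set_signP _ cardF) => [|x]; last first.
    have -> : zgr_coef (P - N) x = class_sign w f true l x.
      by rewrite /P /N !coefE /class_sign /=; ring.
    exact: (class_sign_pm prim_w).
  have corrE g : correlation (zgr_coef (P - N)) (zgr_coef (P - N)) g =
      correlation (class_sign w f true l) (class_sign w f true l) g.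
    by apply: eq_bigr => h _; rewrite /P /N !coefE /class_sign /=; ring.
  have lambdaE : ((q%:Z - 9) %/ 4)%Z = f%:Z - true%:R * 2 by lia.
  have tE (t : int) : 4 * t ^+ 2 + 9 = 4 * t ^+ 2 + 1 + true%:R * 8 by lia.
  have := class_sign_correlation_constP p_pr cardF4 prim_w fE true l.
  move=> [to from]; rewrite lambdaE q_eq; split=> [const | [t [t_odd]]].
    have [g g0|t [t_odd]] := to; first by rewrite -corrE const.
    by rewrite -tE => {}tE; exists t.
  by rewrite tE => {}tE g g0; rewrite corrE from //; exists t.
- move=> i j k l ijkl P N.
  have cover m : m \in [set i; j; k; l] by rewrite ijkl inE.
  pose X (x : F) : int := (x \in cyclotomic_class w f i)%:R
    + (x \in cyclotomic_class w f j)%:R - (x \in cyclotomic_class w f k)%:R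
    - (x \in cyclotomic_class w f l)%:R.
  pose sigma (m : nat) : int := (m == i)%:R + (m == j)%:R - (m == k)%:R - (m == l)%:R.
  have XE a : X (w ^+ a) = sigma (a %% 4)%N.
    by rewrite /X /sigma !(cyclotomic_class_expr prim_w).
  have X0 : X 0 = 0 by rewrite /X !(cyclotomic_class0_notin prim_w).
  (* If i and j are cyclically consecutive, X is negated by w^2; if {i, j} is {0, 2} or {1, 3}, it
     is negated by w. *)
  have sigmaP : (sigma 0%N = 1 \/ sigma 0%N = -1) /\ (sigma 1%N = 1 \/ sigma 1%N = -1) /\
     (sigma 2%N = - sigma 0%N /\ sigma 3%N = - sigma 1%N \/
      sigma 1%N = - sigma 0%N /\ sigma 2%N = sigma 0%N /\ sigma 3%N = - sigma 0%N).
    move: (cover 0) (cover 1) (cover 2) (cover 3).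
    rewrite !inE -!val_eqE /sigma; clear.
    case: i => [[|[|[|[|?]]]] ?] //=; case: j => [[|[|[|[|?]]]] ?] //=;
    case: k => [[|[|[|[|?]]]] ?] //=; case: l => [[|[|[|[|?]]]] ?] //= _ _ _ _;
    do ?split; auto.
  have coefX x : zgr_coef (P - N) x = X x - (x == 0)%:R.
    by rewrite /P /N !coefE /X; ring.
  clearbody sigma.
  have X1 x : x != 0 -> X x = 1 \/ X x = -1.
    elim/(primitive_root_ind cardF4 prim_w): x => [|a _]; first by rewrite eqxx.
    by rewrite XE; elim/mod4_ind: (a %% 4)%N; move: sigmaP; lia.
  have XM m a : X (w ^+ m * w ^+ a) = sigma ((m %% 4 + a %% 4) %% 4)%N.
    by rewrite -exprD XE modnDm.
  have XNE a : X (- w ^+ a) = sigma ((2 * f %% 4 + a %% 4) %% 4)%N.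
    by rewrite (opp_expr cardF4 prim_w) XE modnDm.
  have [_ [_ shift]] := sigmaP.
  (* -1 lies in C_0 or C_2; X is odd when -1 is in C_2 and w^2 negates X, and even otherwise. *)
  have XN : (forall x, X (- x) = X x) \/ (forall x, X (- x) = - X x).
    have [f4|f4] : (2 * f %% 4 = 0 \/ 2 * f %% 4 = 2)%N by lia.
      left; elim/(primitive_root_ind cardF4 prim_w) => [|a]; rewrite ?oppr0 //.
      by rewrite XNE XE f4 add0n modn_mod.
    case: shift => [[s2 s3]|[s1 [s2 s3]]]; [right|left];
      elim/(primitive_root_ind cardF4 prim_w) => [|a]; rewrite ?oppr0 ?X0 //;
      rewrite XNE XE f4; elim/mod4_ind: (a %% 4)%N;
      rewrite ?s2 ?s3 ?s1 ?opprK //.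
  have [u u0 Xu] : exists2 u : F, u != 0 & forall x, X (u * x) = - X x.
    have w0 := primitive_element_neq0 prim_w.
    case: shift => [[s2 s3]|[s1 [s2 s3]]]; [exists (w ^+ 2)|exists (w ^+ 1)];
      rewrite ?expf_neq0 //;
      elim/(primitive_root_ind cardF4 prim_w) => [|a]; rewrite ?mulr0 ?X0 //;
      rewrite XM XE; elim/mod4_ind: (a %% 4)%N;
      rewrite ?s2 ?s3 ?s1 ?opprK //.
  exact: (antiperiodic_not_sds cardF4 u0 X0 X1 Xu XN coefX).

- move=> l P N; rewrite (signed_difference_set_signP _ cardF) => [|x]; last first.
    (* The signs are opposite to those of [class_sign], which leaves the autocorrelation
       unchanged. *)
    have -> : zgr_coef (P - N) x = - class_sign w f false l x.
      by rewrite /P /N !coefE /class_sign /=; ring.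
    by case: (class_sign_pm prim_w false l x) => ->; [right | left].
  have corrE g : correlation (zgr_coef (P - N)) (zgr_coef (P - N)) g =
      correlation (class_sign w f false l) (class_sign w f false l) g.
    by apply: eq_bigr => h _; rewrite /P /N !coefE /class_sign /=; ring.
  have lambdaE : ((q%:Z - 1) %/ 4)%Z = f%:Z - false%:R * 2 by lia.
  have tE (t : int) : 4 * t ^+ 2 + 1 = 4 * t ^+ 2 + 1 + false%:R * 8 by lia.
  have := class_sign_correlation_constP p_pr cardF4 prim_w fE false l.
  move=> [to from]; rewrite lambdaE q_eq; split=> [const | [t [t_odd]]].
    have [g g0|t [t_odd]] := to; first by rewrite -corrE const.
    by rewrite -tE => {}tE; exists t.
  by rewrite tE => {}tE g g0; rewrite corrE from //; exists t.
Qed.
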